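(* Let $n\ge 1$ and $T\ge 1$ be integers, let $m_1,\dots,m_T$ be integers with $1\le m_i\le n$, and let $t$ be an integer with $1\le t\le T$. Let $\Omega$ be a set with $n$ elements, and let $S_1,\dots,S_T$ be independent random subsets of $\Omega$, where $S_i$ is uniformly distributed over all subsets of $\Omega$ of cardinality $m_i$. Let $x_{=t}$ be the number of elements of $\Omega$ that belong to exactly $t$ of the sets $S_1,\dots,S_T$, and let $x_{\ge t}$ be the number of elements of $\Omega$ that belong to at least $t$ of them. Then any raw moment (of order $v\ge 1$) of $x_{=t}$ and of $x_{\ge t}$ can be calculated by the formulas $$E\big(x_{=t}^{\,v}\big)=\sum_{1\le i\le v} s_{v,i}\,\|t^i\|_T$$ and $$E\big(x_{\ge t}^{\,v}\big)=\sum_{1\le i\le v} s_{v,i}\,\|[t,T]^i\|_T ,$$ where $s_{v,i}$ are the Stirling numbers of the second kind, and $\|t^i\|_T$ and $\|[t,T]^i\|_T$ are the MAO norms (with parameters $n,m_1,\dots,m_T$) of the $i$-tuples $(t,\dots,t)$ and $([t,T],\dots,[t,T])$ respectively, with $[t,T]=\{t,t+1,\dots,T\}$.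
   Context: Write $[T]=\{1,2,\dots,T\}$. The falling factorial is $(x)_r=x(x-1)\cdots(x-r+1)$ for $r\ge 1$, and $(x)_0=1$. MAO (multi-set allocation occupancy) function: for $r\ge 1$ and subsets $A_1,\dots,A_r\subseteq[T]$, let $k_i$ (for $i\in[T]$) be the number of indices $j\in\{1,\dots,r\}$ with $i\in A_j$, and define $$g(A_1,\dots,A_r)=\prod_{i=1}^{T}\big[(m_i)_{k_i}\,(n-m_i)_{r-k_i}\big].$$ MAO norm of a tuple of integers: for $p_1,\dots,p_r\in\{1,\dots,T\}$, $$\|(p_1,\dots,p_r)\|_T=\frac{1}{((n)_r)^{T-1}}\sum_{\substack{A_1,\dots,A_r\subseteq[T]\\ |A_1|=p_1,\dots,|A_r|=p_r}} g(A_1,\dots,A_r).$$ MAO norm of a tuple of sets: for $B_1,\dots,B_r\subseteq[T]$, $$\|(B_1,\dots,B_r)\|_T=\frac{1}{((n)_r)^{T-1}}\sum_{\substack{A_1,\dots,A_r\subseteq[T]\\ |A_1|\in B_1,\dots,|A_r|\in B_r}} g(A_1,\dots,A_r).$$ The sums run over ordered $r$-tuples $(A_1,\dots,A_r)$ of (not necessarily distinct) subsets of $[T]$. The notation $\|t^i\|_T$ means $\|(t,\dots,t)\|_T$ with $t$ repeated $i$ times, and $\|[t,T]^i\|_T$ means $\|([t,T],\dots,[t,T])\|_T$ with the set $[t,T]$ repeated $i$ times. The Stirling number of the second kind $s_{v,i}$ is the number of partitions of a $v$-element set into $i$ nonempty blocks. *)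

(* Defs.v *)
From HB Require Import structures.
From mathcomp Require Import all_boot all_order all_algebra.
From mathcomp Require Import all_classical all_reals all_analysis.

Set Implicit Arguments.
Unset Strict Implicit.
Unset Printing Implicit Defensive.

Import Order.TTheory GRing.Theory Num.Theory.

Local Open Scope ring_scope.

(* In this file the T-element index set [T] = {1, ..., T} is represented by   *)
(* 'I_T = {0, ..., T-1}; only the labels of the indices are shifted, while    *)
(* cardinalities of subsets of [T] still range over 0, ..., T.                *)

Definition MAO (n T r : nat) (m : 'I_T -> nat) (A : {ffun 'I_r -> {set 'I_T}})
    : nat :=
  (\prod_(i < T)
     (let k := #|[set j : 'I_r | i \in A j]|%SET in
      (m i) ^_ k * (n - m i) ^_ (r - k)))%N.

(* When r > n the denominator vanishes, but then so does every summand        *)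
(* (k <= m i and r - k <= n - m i cannot both hold), so that the totalized    *)
(* division gives the norm the expected value 0.                              *)
Definition MAO_norm (R : realType) (n T r : nat) (m : 'I_T -> nat)
    (p : 'I_r -> nat) : R :=
  (\sum_(A : {ffun 'I_r -> {set 'I_T}} | [forall j, #|A j| == p j])
      (MAO n m A)%:R) / (n ^_ r)%:R ^+ T.-1.

(* The sets of cardinalities are predicates on nat; since #|A j| <= T only     *)
(* their restriction to {0, ..., T} matters.                                  *)
Definition MAO_norm_sets (R : realType) (n T r : nat) (m : 'I_T -> nat)
    (B : 'I_r -> pred nat) : R :=
  (\sum_(A : {ffun 'I_r -> {set 'I_T}} | [forall j, #|A j| \in B j])
      (MAO n m A)%:R) / (n ^_ r)%:R ^+ T.-1.

Definition stirling2 (v i : nat) : nat :=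
  #|[set Q : {set {set 'I_v}} | finset.partition Q [set: 'I_v] & #|Q| == i]%SET|.

Definition multiplicity (T : nat) (U : finType) (F : 'I_T -> {set U}) (a : U)
    : nat :=
  #|[set i : 'I_T | a \in F i]|%SET.

Definition x_eq (T : nat) (U : finType) (t : nat) (F : 'I_T -> {set U}) : nat :=
  #|[set a : U | multiplicity F a == t]|%SET.

Definition x_ge (T : nat) (U : finType) (t : nat) (F : 'I_T -> {set U}) : nat :=
  #|[set a : U | (t <= multiplicity F a)%N]|%SET.

(* {set U} is equipped with its discrete sigma-algebra, so that a random      *)
(* subset of U is a random variable with values in {set U}.                   *)
HB.instance Definition _ (U : finType) := isPointed.Build {set U} finset.set0.

HB.instance Definition _ (U : finType) :=
  @isMeasurable.Build default_measure_display {set U}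
    discrete_measurable discrete_measurable0
    discrete_measurableC discrete_measurableU.

Definition mutually_independent (d d' : measure_display)
    (W : measurableType d) (E : measurableType d') (R : realType)
    (P : probability W R) (I : finType) (X : I -> {RV P >-> E}) : Prop :=
  forall (J : {set I}) (D : I -> set E),
    (forall i, measurable (D i)) ->
    P (\bigcap_(i in [set` J]) (X i @^-1` D i))%classic =
      (\prod_(i in J) P (X i @^-1` D i)%classic)%E.

Definition uniformly_distributed (d : measure_display)
    (W : measurableType d) (R : realType) (P : probability W R) (U : finType)
    (C : {set {set U}}) (X : {RV P >-> {set U}}) : Prop :=
  forall A : {set U},
    distribution P X [set A]%classic = ((A \in C)%:R / #|C|%:R)%:E.

(* Main.v *)
(* Let X be the number of elements whose multiplicity lies in B. Expanding     *)
(* X^v = sum_i s_{v,i} (X)_i reduces the moments to the factorial ones, and   *)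
(* (X)_r counts the injective r-tuples of such elements. Splitting according  *)
(* to the sets A_j of indices i such that S_i contains the j-th point, and    *)
(* using independence, each injective tuple contributes                       *)
(*   prod_i (m_i)_{k_i} (n - m_i)_{r - k_i} / (n)_r;                          *)
(* there are (n)_r such tuples, which leaves the exponent T - 1 in the norm.  *)
Require Import Defs.
From HB Require Import structures.
From mathcomp Require Import all_boot all_order all_algebra.
From mathcomp Require Import all_classical all_reals all_analysis.
From mathcomp Require Import zify ring.

Import Order.TTheory GRing.Theory Num.Theory.

Local Open Scope ring_scope.

Set Implicit Arguments.
Unset Strict Implicit.

(** Both formulas are instances of [expectation_exp_card_multiplicity], for the number X of points
    whose multiplicity satisfies a predicate [B]. By [exp_sum_stirling2], X^v is a Stirling
    combination of falling factorials (X)_r. By [expectation_comp_independent], the expectation is a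
    finite sum with product weights. In that sum, [sum_ffact_card_multiplicity] reads (X)_r as a
    count of injective r-tuples of points and sorts the set families by which sets contain which
    points, so that the sum factors over the T sets. [sum_uniform_draws_trace] evaluates each factor
    as (m_i)_k (n - m_i)_(r-k) / (n)_r, independently of the tuple. Summing over the (n)_r tuples
    cancels one of the T denominators. *)

(** A function with kernel [Q] is constant on blocks and separates them, so it is an injection from
    the blocks to [D] composed with the projection [b]. *)
Lemma card_ffun_kernel (V D : finType) (Q : {set {set V}}) :
  finset.partition Q [set: V]%SET ->
  #|[set f : {ffun V -> D} | preim_partition f [set: V]%SET == Q]%SET| =
    (#|D| ^_ #|Q|)%N.
Proof.
move=> partQ; have [/eqP coverQ _ Q0] := and3P partQ.
have blockQ x : finset.pblock Q x \in Q by rewrite pblock_mem // coverQ inE.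
pose b x : {B | B \in Q} := exist _ (finset.pblock Q x) (blockQ x).
have b_surj B : {x | b x = B}.
  have /set0Pn/sigW[x xB] : val B != finset.set0.
    by apply: contraNneq Q0 => <-; exact: valP.
  by exists x; apply: val_inj; apply: def_pblock xB; [case/and3P: partQ|exact: valP].
pose comp_b (g : {ffun {B | B \in Q} -> D}) : {ffun V -> D} := [ffun x => g (b x)].
have comp_b_inj : injective comp_b.
  move=> g h gh; apply/ffunP => B; have [x <-] := b_surj B.
  by move/ffunP/(_ x): gh; rewrite !ffunE.
rewrite -[in RHS](card_sig (mem Q)) -card_inj_ffuns -(card_imset _ comp_b_inj).
apply: eq_card => f; rewrite inE; apply/idP/imsetP => [/eqP fQ|[g]].
  have sameE x y : (f x == f y) = (finset.pblock Q x == finset.pblock Q y).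
    have eqR : {in [set: V]%SET & &, equivalence_rel (fun x y : V => f x == f y)}.
      by move=> ? ? ? _ _ _; split => // /eqP ->.
    rewrite -(pblock_equivalence_partition eqR) ?inE //.
    rewrite -[equivalence_partition _ _]/(preim_partition f _) fQ.
    by rewrite eq_pblock ?coverQ ?inE //; case/and3P: partQ.
  (* The induced map on blocks evaluates [f] at a chosen representative; the choice is immaterial
     because [f] is constant on blocks. *)
  have gb x : f (sval (b_surj (b x))) = f x.
    by case: b_surj => y /= [yx]; apply/eqP; rewrite sameE yx.
  exists [ffun B => f (sval (b_surj B))]; last by apply/ffunP => x; rewrite !ffunE gb.
  rewrite inE; apply/injectiveP => B C; rewrite !ffunE.
  have [x <-] := b_surj B; have [y <-] := b_surj C.
  by rewrite !gb => /eqP; rewrite sameE => /eqP xy; apply: val_inj.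
rewrite inE => /injectiveP g_inj ->; apply/eqP.
rewrite -[RHS](preim_partition_pblock partQ); apply: eq_imset => x.
apply/setP => y; rewrite !inE !ffunE (inj_eq g_inj).
by rewrite -(inj_eq val_inj).
Qed.

(** Both sides count the functions from ['I_v] to ['I_N], on the right sorted by kernel partition
    and then by its number of blocks. *)
Lemma exp_sum_stirling2 (N v : nat) :
  (N ^ v = \sum_(i < v.+1) stirling2 v i * N ^_ i)%N.
Proof.
rewrite -{1}[N]card_ord -[X in (_ ^ X)%N](card_ord v) -card_ffun -cardsT -sum1_card.
pose ker (f : {ffun 'I_v -> 'I_N}) := preim_partition f [set: 'I_v]%SET.
rewrite (partition_big ker (fun Q => finset.partition Q [set: 'I_v]%SET)) /=; last first.
  by move=> f _; exact: preim_partitionP.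
(* [inord] loses nothing here: blocks are nonempty, so a partition of ['I_v] has at most [v] of them
   ([le_v]). *)
rewrite (partition_big (fun Q : {set {set 'I_v}} => inord #|Q| : 'I_v.+1) xpredT) //=.
apply: eq_bigr => i _; rewrite /stirling2 -sum1_card big_distrl /=.
have le_v Q : finset.partition Q [set: 'I_v]%SET -> (#|Q| < v.+1)%N.
  move=> partQ; rewrite ltnS -[leqRHS]card_ord -cardsT.
  rewrite (card_partition partQ) -sum1_card; apply: leq_sum => B BQ.
  by rewrite card_gt0; have [_ _ Q0] := and3P partQ; apply: contraNneq Q0 => <-.
apply: eq_big => [Q|Q /andP[partQ /eqP Qi]].
  rewrite inE; apply: andb_id2l => /le_v Qv.
  by rewrite -val_eqE /= inordK.
rewrite mul1n -Qi inordK ?le_v // -[in RHS](card_ord N) -card_ffun_kernel //.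
by rewrite -sum1_card; apply: eq_bigl => f; rewrite !inE.
Qed.

Lemma stirling2_0r (v : nat) : (0 < v)%N -> stirling2 v 0 = 0%N.
Proof.
move=> v0; apply/eqP; rewrite cards_eq0; apply/eqP/setP => Q.
rewrite !inE cards_eq0; apply/negbTE/andP => -[/and3P[/eqP cQ _ _] /eqP Q0].
by move: cQ; rewrite Q0 /finset.cover big_set0 => /setP/(_ (Ordinal v0)); rewrite !inE.
Qed.

(** Multiplied by (m-k)! (n-m-(r-k))!, both sides become n!. If r-k > n-m, both sides are 0. *)
Lemma bin_sub_mul_ffact (n m r k : nat) :
  (k <= r)%N -> (r <= n)%N -> (k <= m)%N -> (m <= n)%N ->
  ('C(n - r, m - k) * n ^_ r = 'C(n, m) * (m ^_ k * (n - m) ^_ (r - k)))%N.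
Proof.
move=> kr rn km mn; have [le|lt] := leqP (r - k) (n - m); last first.
  by rewrite bin_small ?[((n - m) ^_ _)%N]ffact_small ?muln0 //; lia.
have e : (n - r - (m - k) = n - m - (r - k))%N by lia.
have le' : (m - k <= n - r)%N by lia.
apply/eqP; rewrite -(eqn_pmul2r (fact_gt0 (m - k))).
rewrite -(eqn_pmul2r (fact_gt0 (n - m - (r - k)))); apply/eqP.
transitivity (n`!).
  by rewrite -(ffact_fact rn) -(bin_fact le') e; ring.
by rewrite -(bin_fact mn) -(ffact_fact km) -(ffact_fact le); ring.
Qed.

(** A set with trace [J] is [f @: J] together with a free choice of m - |J| points outside the image
    of [f], which gives C(|U|-r, m-|J|) sets. The factor (|U|)_r keeps the identity in the
    naturals. *)
Lemma card_draws_trace (U : finType) (r m : nat) (f : 'I_r -> U) (J : {set 'I_r}) :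
  injective f -> (m <= #|U|)%N ->
  (#|[set A : {set U} | (#|A| == m) && ([set j | f j \in A] == J)]%SET| * #|U| ^_ r =
   'C(#|U|, m) * (m ^_ #|J| * (#|U| - m) ^_ (r - #|J|)))%N.
Proof.
move=> f_inj mU.
have rU : (r <= #|U|)%N by rewrite -(card_ord r); exact: leq_card f_inj.
have Jr : (#|J| <= r)%N by rewrite -[leqRHS]card_ord max_card.
have traceS (A : {set U}) : ([set j | f j \in A] == J)%SET -> (f @: J \subset A)%SET.
  by move=> /eqP <-; apply/fintype.subsetP => _ /imsetP[j + ->]; rewrite inE.
have [Jm|mJ] := leqP #|J| m; last first.
  rewrite [X in (_ * (X * _))%N]ffact_small // mul0n muln0.
  rewrite (_ : [set A | _] = finset.set0)%SET ?cards0 //; apply/setP => A; rewrite !inE.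
  apply/negbTE/andP => -[/eqP Am /traceS/subset_leq_card].
  by rewrite card_imset // Am leqNgt mJ.
rewrite -(bin_sub_mul_ffact Jr rU Jm mU); congr muln.
pose I := (f @: [set: 'I_r])%SET.
have cardI : #|~: I|%SET = (#|U| - r)%N.
  by rewrite cardsCs finset.setCK card_imset // cardsT card_ord.
have JI : (f @: J \subset I)%SET by apply: finset.imsetS; exact: finset.subsetT.
have IB (B : {set U}) x : B \subset (~: I)%SET -> x \in I -> x \in B = false.
  by move=> BI xI; apply/negbTE; apply: contraL xI => /(fintype.subsetP BI); rewrite inE.
(* Adjoining [f @: J] is injective on sets [B] that avoid the image [I], since [B] is recovered as
   the part outside [I]. *)
rewrite -cardI -cards_draws -[RHS](@card_in_imset _ _ (fun B => (f @: J) :|: B)%SET); last first.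
  move=> B C; rewrite !inE => /andP[BI _] /andP[CI _] BC; apply/setP => x.
  have [xI|xI] := boolP (x \in I).
    by rewrite (IB _ _ BI xI) (IB _ _ CI xI).
  have xJ : x \notin (f @: J)%SET by apply: contra xI; exact: (fintype.subsetP JI).
  by move/setP/(_ x): BC; rewrite !inE (negbTE xJ).
apply: eq_card => A; rewrite inE; apply/andP/imsetP => [[/eqP Am AJ]|[B + ->]].
  exists (A :\: f @: J)%SET; last by rewrite -{1}(finset.setIidPr (traceS _ AJ)) finset.setID.
  rewrite inE cardsD (finset.setIidPr (traceS _ AJ)) Am card_imset // eqxx andbT.
  apply/fintype.subsetP => x; rewrite !inE => /andP[xJ xA]; apply: contra xJ => /imsetP[j _ xj].
  by rewrite xj imset_f // -(eqP AJ) inE -xj.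
rewrite inE => /andP[BI /eqP Bm].
rewrite cardsU (_ : _ :&: B = finset.set0)%SET; last first.
  by apply/setP => x; rewrite !inE; apply/andP => -[/(fintype.subsetP JI)/(IB _ _ BI) ->].
rewrite cards0 subn0 card_imset // Bm subnKC //; split=> //.
apply/eqP/setP => j; rewrite !inE mem_imset // (IB _ _ BI) ?orbF //.
exact: imset_f.
Qed.

(** The family takes finitely many values, so [h] of it is a finite combination of indicators of the
    events [ev F]; independence over the full index set makes the probability of [ev F] a
    product. *)
Lemma expectation_comp_independent (T : nat) (U : finType) (R : realType)
    (d : measure_display) (W : measurableType d) (P : probability W R)
    (S : 'I_T -> {RV P >-> {set U}}) (C : 'I_T -> {set {set U}})
    (h : {ffun 'I_T -> {set U}} -> R) :
  mutually_independent S ->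
  (forall i, uniformly_distributed (C i) (S i)) ->
  ('E_P[fun w => h [ffun i => S i w]] =
    (\sum_F h F * \prod_i ((F i \in C i)%:R / #|C i|%:R))%R%:E)%E.
Proof.
move=> Sindep Sunif.
pose ev (F : {ffun 'I_T -> {set U}}) : set W :=
  (\bigcap_(i in [set` [set: 'I_T]%SET]) (S i @^-1` [set F i]))%classic.
have mev F : measurable (ev F).
  apply: fin_bigcap_measurable => // i _.
  exact: (measurable_funPTI (S i)).
have Pev F : P (ev F) = (\prod_i ((F i \in C i)%:R / #|C i|%:R) : R)%:E.
  rewrite Sindep // -prodEFin; apply: eq_big => [i|i _]; first by rewrite inE.
  exact: Sunif.
have hE w : (h [ffun i => S i w])%:E = (\sum_F (h F)%:E * (\1_(ev F) w)%:E)%E.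
  rewrite (bigD1 [ffun i => S i w]) //= big1 ?adde0 => [|F FS].
    by rewrite indicE mem_set ?mule1 // => i _ /=; rewrite ffunE.
  rewrite indicE memNset ?mule0 // => wF; move/eqP: FS; apply; apply/ffunP => i.
  by rewrite ffunE; apply/esym/wF; rewrite /= inE.
rewrite unlock; under eq_integral do rewrite hE.
rewrite integral_sum //; last first.
  by move=> F; apply: integrableZl => //; exact: integrable_indic.
rewrite -sumEFin; apply: eq_bigr => F _.
by rewrite EFinM -Pev integralZl ?integrable_indic // integral_indic // setIT.
Qed.

(** With A_j the set of indices i such that F_i contains f(j), the multiplicity of f(j) is |A_j|.
    Once [f] and [A] are fixed, the remaining condition on [F] concerns each F_i separately, so the
    sum of products is a product of sums. *)
Lemma sum_ffact_card_multiplicity (T r : nat) (U : finType) (R : comPzRingType)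
    (B : pred nat) (q : 'I_T -> {set U} -> R) :
  \sum_(F : {ffun 'I_T -> {set U}})
     (#|[set a | B (multiplicity F a)]%SET| ^_ r)%:R * \prod_i q i (F i) =
  \sum_(f : {ffun 'I_r -> U} | injectiveb f)
    \sum_(A : {ffun 'I_r -> {set 'I_T}} | [forall j, B #|A j|])
      \prod_i \sum_(D : {set U} | [set j | f j \in D]%SET == [set j | i \in A j]%SET) q i D.
Proof.
have ffactE (F : {ffun 'I_T -> {set U}}) :
    (#|[set a | B (multiplicity F a)]%SET| ^_ r)%:R * \prod_i q i (F i) =
    \sum_(f : {ffun 'I_r -> U} | injectiveb f && [forall j, B (multiplicity F (f j))])
      \prod_i q i (F i).
  rewrite -[r in LHS]card_ord -card_inj_ffuns_on -sum1_card natr_sum big_distrl /=.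
  apply: eq_big => [f|f _]; last by rewrite mul1r.
  rewrite !inE andbC; congr (_ && _).
  by apply/ffun_onP/forallP => h j; have := h j; rewrite inE.
under eq_bigr do rewrite ffactE.
rewrite (exchange_big_dep (fun f : {ffun 'I_r -> U} => injectiveb f)) /=; last first.
  by move=> ? ? _ /andP[].
apply: eq_bigr => f ->.
pose tr (F : {ffun 'I_T -> {set U}}) : {ffun 'I_r -> {set 'I_T}} :=
  [ffun j => [set i | f j \in F i]%SET].
rewrite (partition_big tr (fun A : {ffun 'I_r -> {set 'I_T}} => [forall j, B #|A j|])) /=;
  last first.
  by move=> F /forallP BF; apply/forallP => j; rewrite ffunE; exact: BF.
apply: eq_bigr => A BA; rewrite bigA_distr_big_dep; apply: eq_bigl => F.
apply/andP/familyP => [[_ /eqP <-] i|FA].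
  by apply/eqP/setP => j; rewrite !inE ffunE inE.
suff FAE : tr F = A.
  rewrite FAE eqxx; split=> //; apply/forallP => j; move/forallP/(_ j): BA.
  by rewrite -FAE ffunE.
apply/ffunP => j; apply/setP => i; rewrite ffunE inE.
by have /eqP/setP/(_ j) := FA i; rewrite !inE.
Qed.

Lemma sum_uniform_draws_trace (U : finType) (r m : nat) (R : realType)
    (f : 'I_r -> U) (J : {set 'I_r}) :
  injective f -> (m <= #|U|)%N ->
  let C := [set A : {set U} | #|A| == m]%SET in
  \sum_(D : {set U} | [set j | f j \in D]%SET == J) ((D \in C)%:R / #|C|%:R) =
    (m ^_ #|J| * (#|U| - m) ^_ (r - #|J|))%:R / (#|U| ^_ r)%:R :> R.
Proof.
move=> f_inj mU C.
have rU : (r <= #|U|)%N by rewrite -(card_ord r); exact: leq_card f_inj.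
have cardC : #|C| = 'C(#|U|, m).
  rewrite -cardsT -cards_draws; apply: eq_card => A.
  by rewrite !inE finset.subsetT.
have C0 : #|C|%:R != 0 :> R by rewrite pnatr_eq0 -lt0n cardC bin_gt0.
have r0 : (#|U| ^_ r)%:R != 0 :> R by rewrite pnatr_eq0 -lt0n ffact_gt0.
rewrite -big_distrl /= -natr_sum.
apply/eqP; rewrite eqr_div // -!natrM cardC [X in _ == X%:R]mulnC.
rewrite -(card_draws_trace J f_inj mU).
apply/eqP; congr (_%:R); congr (_ * _)%N.
rewrite -sum1_card big_mkcond [RHS]big_mkcond; apply: eq_bigr => A _ /=.
by rewrite !inE andbC; case: (_ == J); case: (_ == m).
Qed.

(** Already the factor of a single index vanishes: k <= m_i and r-k <= n-m_i would force r <= n. *)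
Lemma MAO_small (n T r : nat) (m : 'I_T -> nat) (A : {ffun 'I_r -> {set 'I_T}}) :
  (0 < T)%N -> (forall i, m i <= n)%N -> (n < r)%N -> MAO n m A = 0%N.
Proof.
move=> T0 mn nr; rewrite /MAO (bigD1 (Ordinal T0)) //=.
set k := #|_|; have mTn := mn (Ordinal T0); have [mk|km] := ltnP (m (Ordinal T0)) k.
  by rewrite [X in (X * _ * _)%N]ffact_small.
by rewrite [X in (_ * X * _)%N]ffact_small ?muln0 //; lia.
Qed.

Lemma expectation_exp_card_multiplicity (n T : nat) (m : 'I_T -> nat) (B : pred nat)
    (v : nat) (Omega : finType) (R : realType) (d : measure_display)
    (W : measurableType d) (P : probability W R) (S : 'I_T -> {RV P >-> {set Omega}}) :
  (0 < T)%N -> (forall i, m i <= n)%N -> (0 < v)%N -> #|Omega| = n ->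
  mutually_independent S ->
  (forall i, uniformly_distributed [set A : {set Omega} | #|A| == m i]%SET (S i)) ->
  ('E_P[(fun w => #|[set a | B (multiplicity (fun i => S i w) a)]%SET|%:R ^+ v)%R] =
    (\sum_(1 <= i < v.+1)
       (stirling2 v i)%:R * MAO_norm_sets R n m (fun _ : 'I_i => B))%R%:E)%E.
Proof.
move=> T0 mn v0 cardOmega Sindep Sunif; subst n.
pose X (F : {ffun 'I_T -> {set Omega}}) := #|[set a | B (multiplicity F a)]%SET|.
pose C i := [set A : {set Omega} | #|A| == m i]%SET.
transitivity 'E_P[(fun w => (X [ffun i => S i w])%:R ^+ v)%R]%E.
  congr expectation; apply/funext => w; congr (_%:R ^+ _); apply: eq_card => a.
  by rewrite !inE; congr B; apply: eq_card => i; rewrite !inE ffunE.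
rewrite (expectation_comp_independent (fun F => (X F)%:R ^+ v) Sindep Sunif); congr EFin.
under eq_bigr do rewrite -natrX (exp_sum_stirling2 _ v) natr_sum big_distrl /=.
(* The term of index 0 drops out because [v] is positive, so the sum may start at 1. *)
rewrite exchange_big /= big_ord_recl /= big1 ?add0r => [|F _]; last first.
  by rewrite stirling2_0r ?mul0n ?mul0r.
rewrite big_add1 /= big_mkord; apply: eq_bigr => r _.
rewrite /bump /= add1n; move: r.+1 => {}r.
under eq_bigr do rewrite natrM -mulrA.
rewrite -big_distrr /=; congr (_ * _).
rewrite (sum_ffact_card_multiplicity r B
  (fun i D => (D \in C i)%:R / #|C i|%:R)) /=.
under eq_bigr => f /injectiveP f_inj.
  under eq_bigr => A _.
    under eq_bigr => i _ do rewrite (sum_uniform_draws_trace R _ f_inj (mn i)).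
    rewrite prodf_div -natr_prod prodr_const card_ord.
    over.
  over.
(* The summand no longer depends on [f], so summing over injective tuples multiplies by their number
   (n)_r. *)
rewrite sumr_const -cardsE card_inj_ffuns card_ord -big_distrl /= /MAO_norm_sets.
(* For r > n there are no injective tuples and (n)_r = 0 cannot be cancelled; both sides are 0. *)
have [rn|nr] := leqP r #|Omega|; last first.
  rewrite ffact_small // mulr0n big1 ?mul0r // => A _.
  by rewrite (MAO_small _ T0 mn nr).
have r0 : (#|Omega| ^_ r)%:R != 0 :> R by rewrite pnatr_eq0 -lt0n ffact_gt0.
rewrite -[LHS]mulr_natr -mulrA; congr (_ * _).
by rewrite -[in LHS](prednK T0) exprS invfM mulrAC mulVf // mul1r.
Qed.

Unset Implicit Arguments.

Theorem theorem1 (n T : nat) (m : 'I_T -> nat) (t v : nat)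
    (hn : (1 <= n)%N) (hT : (1 <= T)%N)
    (hm : forall i : 'I_T, (1 <= m i <= n)%N)
    (ht : (1 <= t <= T)%N) (hv : (1 <= v)%N)
    (Omega : finType) (hOmega : #|Omega| = n)
    (R : realType) (d : measure_display) (W : measurableType d)
    (P : probability W R)
    (S : 'I_T -> {RV P >-> {set Omega}})
    (Sindep : mutually_independent S)
    (Sunif : forall i : 'I_T,
       uniformly_distributed [set A : {set Omega} | #|A| == m i]%SET (S i)) :
  ('E_P[(fun w => (x_eq t (fun i => S i w))%:R ^+ v)%R] =
     (\sum_(1 <= i < v.+1)
        (stirling2 v i)%:R * MAO_norm R n m (fun _ : 'I_i => t))%R%:E)%E /\
  ('E_P[(fun w => (x_ge t (fun i => S i w))%:R ^+ v)%R] =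
     (\sum_(1 <= i < v.+1)
        (stirling2 v i)%:R *
          MAO_norm_sets R n m (fun _ : 'I_i => [pred k | (t <= k <= T)%N]))%R%:E)%E.
Proof.
have mn i : (m i <= n)%N by case/andP: (hm i).
split; first exact: (expectation_exp_card_multiplicity (pred1 t) hT mn hv hOmega Sindep Sunif).
(* The upper bound [T] is automatic, a multiplicity being the cardinality of a subset of ['I_T]. *)
rewrite -(expectation_exp_card_multiplicity [pred k | (t <= k <= T)%N]
  hT mn hv hOmega Sindep Sunif).
congr expectation; apply/funext => w; congr (_%:R ^+ _); apply: eq_card => a.
by rewrite !inE [X in _ && X](leq_trans (max_card _)) ?andbT // card_ord.
Qed.
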